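(* Let $k\ge2$, let $f_0:[0,1]^m\to\mathbb{R}^n$ be a map of class $C^k$, let $j\in\{1,\dots,m\}$, and let $\gamma:[0,1]^m\times\mathbb{R}/\mathbb{Z}\to\mathbb{R}^n$ be a loop family such that $x\mapsto\gamma(x,\cdot)$ is $C^{k-1}$ and $t\mapsto\gamma(\cdot,t)$ is $C^{k-2}$. For $N\in\,]0,+\infty[$ let $f_1:[0,1]^m\to\mathbb{R}^n$ be obtained from $f_0$ by the Corrugation Process in the direction $\partial_j$: $$f_1(x)=f_0(x)+\frac1N\Gamma(x,Nx_j),\qquad \Gamma(x,t)=\int_0^t\big(\gamma(x,s)-\overline{\gamma}(x)\big)\,ds,\qquad \overline{\gamma}(x)=\int_0^1\gamma(x,s)\,ds.$$ Then $f_1$ is of class $C^{k-1}$ and: - $(P_1)$ $\|f_0-f_1\|_\infty=O(1/N)$; - $(P_2)$ $\|\partial_if_0-\partial_if_1\|_\infty=O(1/N)$ for every $i\ne j$; - $(P_3')$ if $\gamma$ satisfies the Average Constraint $\partial_jf_0(x)=\int_0^1\gamma(x,t)\,dt$ for all $x\in[0,1]^m$, then $\partial_jf_1(x)=\gamma(x,Nx_j)+O(1/N)$ for all $x\in[0,1]^m$.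
   Context: $\partial_i$ denotes the partial derivative in the $i$-th coordinate direction and $\|\cdot\|_\infty$ the sup norm over $[0,1]^m$. $O(1/N)$ means bounded in norm by $C/N$ with a constant $C$ independent of $N$ and of $x$. The regularity condition on $\gamma$ is understood as: $x\mapsto\gamma(x,\cdot)$ is a $C^{k-1}$ map from $[0,1]^m$ to $C^{k-2}(\mathbb{R}/\mathbb{Z},\mathbb{R}^n)$. *)

(* Defs.v *)
From HB Require Import structures.
From mathcomp Require Import all_boot all_order all_algebra.
From mathcomp Require Import all_classical all_reals all_analysis.

Set Implicit Arguments.
Unset Strict Implicit.
Unset Printing Implicit Defensive.

Import Order.TTheory GRing.Theory Num.Theory.
Import numFieldNormedType.Exports.

Local Open Scope classical_set_scope.
Local Open Scope ring_scope.

Section CubeCalculus.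
Context {R : realType} {m : nat} {V : normedModType R}.
Implicit Types (f : 'rV[R]_m -> V) (x : 'rV[R]_m).

Definition cube : set 'rV[R]_m := [set x | forall i, x ord0 i \in `[0, 1]].

(* The limit is taken along the nonzero h for which x + h e_i stays in the
   cube: it is the usual partial derivative when 0 < x_i < 1 and the one-sided
   one when x_i is 0 or 1.  Maps on the cube are represented by total maps on
   R^m whose values outside of the cube are never used. *)
Definition cube_step (i : 'I_m) x (h : R) : 'rV[R]_m :=
  x + h *: delta_mx ord0 i.

Definition cube_quot (i : 'I_m) f x (h : R) : V :=
  h^-1 *: (f (cube_step i x h) - f x).

Definition cube_dnbhs (i : 'I_m) x : set_system R :=
  within [set h | cube (cube_step i x h)] 0^'.

Definition partial (i : 'I_m) f x : V :=
  lim (cube_quot i f x @ cube_dnbhs i x).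

Fixpoint cube_class (r : nat) f : Prop :=
  match r with
  | 0 => {within cube, continuous f}
  | r'.+1 => {within cube, continuous f} /\
      forall i : 'I_m,
        (forall x, cube x -> cvg (cube_quot i f x @ cube_dnbhs i x)) /\
        cube_class r' (partial i f)
  end.

(* Extended-real valued, so that an unbounded map has norm +oo (the real-valued
   sup of an unbounded set is 0 by convention). *)
Definition cube_supnorm f : \bar R := ereal_sup [set `|f x|%:E | x in cube].

End CubeCalculus.

(* The space C^s(R/Z, R^n): 1-periodic maps R -> R^n of class C^s, with the norm
   max_(l <= s) sup_t |g^(l)(t)|.  The sups are over nonempty bounded sets
   (dnormset_sup), as l-th derivatives are continuous and periodic. *)
Section Loops.
Context {R : realType} {n s : nat}.
Implicit Types g : R -> 'rV[R]_n.

Definition class_C g : Prop :=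
  (forall l, (l < s)%N -> forall t, derivable (derive1n l g) t 1) /\
  continuous (derive1n s g).

Definition is_loop g : Prop := class_C g /\ forall t, g (t + 1) = g t.

Definition loops : {pred R -> 'rV[R]_n} := [pred g | `[< is_loop g >]].

Lemma loopsP g : reflect (is_loop g) (g \in loops).
Proof. by rewrite inE; exact: asboolP. Qed.

Record loop := Loop { loop_fun :> R -> 'rV[R]_n; loopP : loop_fun \in loops }.

HB.instance Definition _ := [isSub for loop_fun].
HB.instance Definition _ := [Choice of loop by <:].

Lemma derive1n_lin l (a : R) (f g : R -> 'rV[R]_n) :
  (forall l', (l' < l)%N -> forall t, derivable (derive1n l' f) t 1) ->
  (forall l', (l' < l)%N -> forall t, derivable (derive1n l' g) t 1) ->
  derive1n l (a *: f + g) = a *: derive1n l f + derive1n l g.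
Proof.
elim: l => [//|l IH] df dg.
rewrite !derive1nS IH; last 2 first.
- by move=> l' ll; apply: df; exact: ltnW.
- by move=> l' ll; apply: dg; exact: ltnW.
apply/funext => t; rewrite [RHS]/GRing.add /= [in RHS]/GRing.scale /=.
have dfl := df l (ltnSn l) t; have dgl := dg l (ltnSn l) t.
rewrite !derive1E; have := deriveD (@derivableZ _ _ _ _ a _ _ dfl) dgl.
by rewrite (deriveZ _ dfl).
Qed.

Lemma loops_submod : submod_closed loops.
Proof.
have d0 l : derive1n l (0 : R -> 'rV[R]_n) = 0.
  elim: l => [//|l IH]; rewrite derive1nS IH; apply/funext => t.
  by rewrite derive1E -[0]/(cst 0) derive_cst.
split.
  apply/loopsP; split => [|//]; split => [l _ t|].
    by rewrite d0 -[0]/(cst 0); exact: derivable_cst.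
  by rewrite d0 -[0]/(cst 0) => t; exact: cvg_cst.
move=> a f g /loopsP[[df cf] pf] /loopsP[[dg cg] pg].
apply/loopsP; split; last first.
  by move=> t; rewrite /GRing.add /= /GRing.scale /= pf pg.
split=> [l ls t|].
  rewrite derive1n_lin; [|by move=> l' ll; apply: df; exact: ltn_trans ls
    |by move=> l' ll; apply: dg; exact: ltn_trans ls].
  by apply: derivableD; [apply: derivableZ; exact: df|exact: dg].
rewrite derive1n_lin// => t; apply: cvgD; last exact: cg.
by apply: cvgZl_tmp; exact: cf.
Qed.

HB.instance Definition _ := GRing.isSubmodClosed.Build _ _ loops loops_submod.
HB.instance Definition _ := [SubChoice_isSubLmodule of loop by <:].

Implicit Types u v : loop.

Lemma loop_is_loop u : is_loop u.
Proof. exact/loopsP/loopP. Qed.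

Lemma loop_derivable u l t : (l < s)%N -> derivable (derive1n l u) t 1.
Proof. by move=> ls; have [[+ _] _] := loop_is_loop u; exact. Qed.

Lemma loop_continuous u l : (l <= s)%N -> continuous (derive1n l u).
Proof.
rewrite leq_eqVlt => /orP[/eqP->|ls]; first by case: (loop_is_loop u) => -[].
move=> t; apply: differentiable_continuous.
by apply/derivable1_diffP; exact: loop_derivable.
Qed.

Lemma loop_derive_periodic u l t : derive1n l u (t + 1) = derive1n l u t.
Proof.
elim: l t => [|l IH] t; first by have [_ pu] := loop_is_loop u; exact: pu.
rewrite derive1nS /derive1; set q := (fun h => _); set q' := (fun h => _).
by suff -> : q = q' by []; apply/funext => h; rewrite /q /q' addrA !IH.
Qed.

Lemma periodicz (W : Type) (f : R -> W) (z : int) t :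
  (forall t, f (t + 1) = f t) -> f (t + z%:~R) = f t.
Proof.
move=> pf; have pn (k : nat) t' : f (t' + k%:R) = f t'.
  by elim: k t' => [|k IH] t'; rewrite ?addr0// -natr1 addrA pf.
case: z => k; first exact: pn.
by rewrite NegzE -[in RHS](subrK (k.+1%:R) t) pn mulrNz.
Qed.

Definition dnormset u (l : nat) : set R := range (fun t => `|derive1n l u t|).

Definition loop_norm u : R := \big[Num.max/0]_(l < s.+1) sup (dnormset u l).

Lemma dnormset_sup u l : (l <= s)%N -> has_sup (dnormset u l).
Proof.
move=> ls; split; first by exists `|derive1n l u 0|, 0.
have cu : {within `[0, 1], continuous (derive1n l u)}.
  by apply: continuous_subspaceT; exact: loop_continuous.
have [M [Mr MP]] := compact_bounded (continuous_compact cu (@segment_compact R 0 1)).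
exists (M + 1) => _ [t _ <-].
apply: (MP (M + 1)); first by rewrite ltrDl.
exists (t - (Num.floor t)%:~R) => /=.
  rewrite in_itv /= subr_ge0 floor_le_tmp /= lerBlDl.
  by rewrite ltW// -[1]/(1%:~R) -intrD floorD1_gt.
by rewrite -mulrNz; apply: periodicz => t'; exact: loop_derive_periodic.
Qed.

Lemma loop_norm_ub u l t : (l <= s)%N -> `|derive1n l u t| <= loop_norm u.
Proof.
move=> ls; have lss : (l < s.+1)%N by [].
apply: le_trans (le_bigmax _ (fun l : 'I_s.+1 => sup (dnormset u l)) (Ordinal lss)).
apply: ub_le_sup; [by case: (dnormset_sup u ls)|by exists t].
Qed.

Lemma loop_norm_ge0 u : 0 <= loop_norm u.
Proof. exact: bigmax_ge_id. Qed.

Lemma loop_norm_le u (M : R) : 0 <= M ->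
  (forall l t, (l <= s)%N -> `|derive1n l u t| <= M) -> loop_norm u <= M.
Proof.
move=> M0 uM; apply: bigmax_le => // l _.
by apply: ge_sup => [|_ [t _ <-]]; [exists `|derive1n l u 0|, 0|apply: uM; rewrite -ltnS].
Qed.

Lemma loop_deriveZ (a : R) u l t : (l <= s)%N ->
  derive1n l (a *: u) t = a *: derive1n l u t.
Proof.
move=> ls; rewrite -[a *: u]addr0.
have -> : (a *: u + 0 : loop) = a *: (u : R -> 'rV_n) + (0 : loop) :> (R -> _) by [].
rewrite derive1n_lin => [|l' ll t'|l' ll t'];
  [|exact/loop_derivable/(leq_trans ll)|exact/loop_derivable/(leq_trans ll)].
have z : derive1n l ((0 : loop) : R -> 'rV[R]_n) t = 0.
  have -> : ((0 : loop) : R -> 'rV[R]_n) = cst 0 by [].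
  elim: l t {ls} => [//|l IH] t; rewrite derive1nS.
  have -> : derive1n l (cst (0 : 'rV[R]_n) : R -> _) = cst (0 : 'rV[R]_n) by apply/funext.
  by rewrite derive1E derive_cst.
by rewrite /GRing.add /= z addr0.
Qed.

Lemma loop_deriveD u v l t : (l <= s)%N ->
  derive1n l (u + v) t = derive1n l u t + derive1n l v t.
Proof.
move=> ls.
have -> : (u + v : loop) = 1 *: (u : R -> 'rV_n) + v :> (R -> _).
  by rewrite scale1r.
rewrite derive1n_lin => [|l' ll t'|l' ll t'];
  [|exact/loop_derivable/(leq_trans ll)|exact/loop_derivable/(leq_trans ll)].
by rewrite scale1r.
Qed.

Lemma loop_normD u v : loop_norm (u + v) <= loop_norm u + loop_norm v.
Proof.
apply: loop_norm_le => [|l t ls]; first by rewrite addr_ge0 ?loop_norm_ge0.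
rewrite loop_deriveD//; apply: le_trans (ler_normD _ _) _.
by apply: lerD; exact: loop_norm_ub.
Qed.

Lemma loop_normZ (a : R) u : loop_norm (a *: u) = `|a| * loop_norm u.
Proof.
have le b v : loop_norm (b *: v) <= `|b| * loop_norm v.
  apply: loop_norm_le => [|l t ls]; first by rewrite mulr_ge0 ?loop_norm_ge0.
  by rewrite loop_deriveZ// normrZ ler_wpM2l// loop_norm_ub.
apply/eqP; rewrite eq_le le /=.
have [->|a0] := eqVneq a 0; first by rewrite normr0 mul0r loop_norm_ge0.
have := le a^-1 (a *: u); rewrite scalerA mulVf// scale1r => h.
by rewrite -ler_pdivlMl ?normr_gt0// -normfV.
Qed.

Lemma loop_norm_eq0 u : loop_norm u = 0 -> u = 0.
Proof.
move=> u0; apply/val_inj/funext => t /=; apply/eqP.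
rewrite -normr_eq0 eq_le normr_ge0 andbT -u0.
exact: (@loop_norm_ub u 0 t).
Qed.

HB.instance Definition _ := @Lmodule_isNormed.Build R loop
  loop_norm loop_normD loop_normZ loop_norm_eq0.

End Loops.
Arguments loop : clear implicits.

Section Corrugation.
Context {R : realType} {n : nat}.
Implicit Types g : R -> 'rV[R]_n.

(* Componentwise oriented integral of g from a to b: at most one of the two
   terms is nonzero, according to the order of a and b. *)
Definition vint (a b : R) g : 'rV[R]_n :=
  \row_i (\int[lebesgue_measure]_(t in `[a, b]) g t ord0 i -
          \int[lebesgue_measure]_(t in `[b, a]) g t ord0 i).

Definition loop_average g : 'rV[R]_n := vint 0 1 g.

Definition loop_primitive g (t : R) : 'rV[R]_n :=
  vint 0 t (fun s => g s - loop_average g).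

Definition corrugation {m : nat} (f0 : 'rV[R]_m -> 'rV[R]_n)
    (gamma : 'rV[R]_m -> R -> 'rV[R]_n) (j : 'I_m) (N : R)
    (x : 'rV[R]_m) : 'rV[R]_n :=
  f0 x + N^-1 *: loop_primitive (gamma x) (N * x ord0 j).

End Corrugation.

(* Main.v *)
Require Import Defs.
From HB Require Import structures.
From mathcomp Require Import all_boot all_order all_algebra.
From mathcomp Require Import all_classical all_reals all_analysis.
From mathcomp Require Import lra.

Set Implicit Arguments.
Unset Strict Implicit.
Unset Printing Implicit Defensive.

Import Order.TTheory GRing.Theory Num.Theory.
Import numFieldNormedType.Exports.

Local Open Scope classical_set_scope.
Local Open Scope ring_scope.

(** The corrugation adds to f_0 the term N^-1 P(G x)(N x_j), where G = gamma is
    the family of loops and P u = [loop_primitive u] is the primitive, vanishing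
    at 0, of the loop u minus its average.  Removing the average is what makes
    P u periodic, hence bounded on the whole line by 2 |u|
    ([loop_primitive_norm]); without it P u would grow linearly and the
    corrugation would be of order 1 instead of 1/N.

    The derivatives of P are treated all at once.  For l <= s + 1 let
    J_l u t = derive1n l (P u) t ([primitive_jet]), where u lies in the space
    C^s of loops, s = k - 2.  As (P u)' is again a loop, namely u minus its
    average, J_l is linear in u, bounded by 2 |u| uniformly in t, continuous
    in t, and its t-derivative is J_(l+1) when l <= s.  So if l <= s and G is a
    C^1 family of loops on the cube, the function x |-> J_l (G x) (N x_j) has
    i-th partial derivative
      J_l (partial i G x) (N x_j) + N [i = j] J_(l+1) (G x) (N x_j)
    ([has_partial_jet]).  Each term either differentiates the family or raises l,
    so that, by induction on r, x |-> J_l (G x) (N x_j) is C^r as soon as G is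
    C^r and l + r <= s + 1 ([jet_class]).  With l = 0 and r = s + 1 this is the
    C^(k-1) regularity of f_1.

    The same formula with l = 0, multiplied by N^-1, yields the estimates
    ([partial_corrugation]):
      partial i f_1 x = partial i f_0 x + N^-1 P(partial i G x)(N x_j)
                        + [i = j] (G x (N x_j) - average of G x),
    and the middle term is O(1/N) because partial i G is continuous, hence
    bounded, on the compact cube ([jet_field_bound]); the estimate of f_0 - f_1
    is the same with G in place of partial i G.  For i = j the Average
    Constraint cancels partial j f_0 against the average. *)

(** * Row vectors and the oriented integral *)

Section RowVectors.
Context {R : realType} {n : nat}.
Implicit Types (v : 'rV[R]_n) (F dF : R -> 'rV[R]_n) (M a b t : R).

Lemma row_norm_le v (M : R) :
  0 <= M -> (forall i, `|v ord0 i| <= M) -> `|v| <= M.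
Proof.
move=> M0 vM; rewrite [leLHS]/Num.Def.normr/= mx_normrE.
by apply: bigmax_le => // -[a i] _ /=; rewrite ord1.
Qed.

Lemma entry_norm_le v i : `|v ord0 i| <= `|v|.
Proof.
rewrite [in leRHS]/Num.Def.normr/= mx_normrE.
exact: (le_bigmax _ (fun ij : 'I_1 * 'I_n => `|v ij.1 ij.2|) (ord0, i)).
Qed.

Lemma is_derive_row F (t : R) v :
  (forall i, is_derive t 1 (fun s => F s ord0 i) (v ord0 i)) ->
  is_derive t 1 F v.
Proof.
move=> dF.
have DF : derivable F t 1.
  by apply/derivable_mxP => a i; rewrite ord1; case: (dF i).
apply: DeriveDef => //; rewrite derive_mx//; apply/rowP => i; rewrite mxE.
by case: (dF i).
Qed.

Lemma is_derive_entry F (t : R) v i :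
  is_derive t 1 F v -> is_derive t 1 (fun s => F s ord0 i) (v ord0 i).
Proof.
move=> [DF <-]; apply: DeriveDef; first by move/derivable_mxP: (DF); exact.
by rewrite derive_mx// mxE.
Qed.

Lemma continuous_entry F i : continuous F -> continuous (fun t => F t ord0 i).
Proof.
move=> cF t.
apply: (@continuous_comp _ _ _ F (fun v : 'rV[R]_n => v ord0 i)); first exact: cF.
exact: coord_continuous.
Qed.

(** The mean value theorem fails for vector-valued maps, but the norm is the
    maximum of the entries, so the inequality follows from the scalar case. *)
Lemma mean_value_le F dF (M a b : R) :
  (forall t, is_derive t 1 F (dF t)) -> (forall t, `|dF t| <= M) ->
  a <= b -> `|F b - F a| <= M * (b - a).
Proof.
move=> DF dFM ab.
have M0 : 0 <= M by exact: le_trans (normr_ge0 _) (dFM 0).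
apply: row_norm_le => [|i]; first by rewrite mulr_ge0// subr_ge0.
rewrite !mxE.
have DFi t := is_derive_entry i (DF t).
have cF : {within `[a, b], continuous (fun s => F s ord0 i)}.
  apply: continuous_subspaceT => x; apply: differentiable_continuous.
  by apply/derivable1_diffP; case: (DFi x).
have [c _ ->] := MVT_segment ab (fun x _ => DFi x) cF.
rewrite normrM (ger0_norm (_ : 0 <= b - a)) ?subr_ge0// ler_wpM2r ?subr_ge0//.
exact: le_trans (entry_norm_le _ _) (dFM _).
Qed.

End RowVectors.

Section OrientedIntegral.
Context {R : realType} {n : nat}.
Notation mu := (@lebesgue_measure R).
Implicit Types g : R -> 'rV[R]_n.

Lemma continuous_integrable (f : R -> R) a b :
  continuous f -> mu.-integrable `[a, b] (EFin \o f).
Proof.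
move=> cf; apply: continuous_compact_integrable; first exact: segment_compact.
exact: continuous_subspaceT.
Qed.

(** Integrating from a common lower bound c turns the two-sided expression into
    a difference of values of one function of the upper bound, to which the
    fundamental theorem of calculus applies whatever the order of a and b. *)
Lemma oriented_integralE (f : R -> R) (c a b : R) :
  continuous f -> c <= a -> c <= b ->
  \int[mu]_(t in `[a, b]) f t - \int[mu]_(t in `[b, a]) f t =
  \int[mu]_(t in `[c, b]) f t - \int[mu]_(t in `[c, a]) f t.
Proof.
move=> cf; wlog ab : a b / a <= b.
  move=> H ca cb; have /orP[ab|ba] := le_total a b; first exact: H.
  by rewrite -opprB H// opprB.
move=> ca cb; rewrite Rintegral_itvB ?bnd_simp//; last exact: continuous_integrable.
rewrite Rintegral_itv_obnd_cbnd; last first.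
  apply: integrableS (continuous_integrable a b cf) => //.
  by apply: subset_itvr; rewrite bnd_simp.
move: ab; rewrite le_eqVlt => /predU1P[->|ab].
  by rewrite set_itv1 Rintegral_set1 subrr.
by rewrite (@set_itv_ge _ _ (BLeft b)) ?bnd_simp -?ltNge// Rintegral_set0 subr0.
Qed.

Lemma is_derive_vint g (a t : R) :
  continuous g -> is_derive t 1 (fun t => vint a t g) (g t).
Proof.
move=> cg; apply: is_derive_row => i.
have cgi := continuous_entry (i := i) cg.
(* The fundamental theorem of calculus needs a lower bound strictly to the left
   of the point of differentiation. *)
pose c := Num.min a t - 1.
have ca : c < a.
  by rewrite ltrBlDr (@le_lt_trans _ _ a)// ?ltrDl// ge_min lexx.
have ct : c < t.
  by rewrite ltrBlDr (@le_lt_trans _ _ t)// ?ltrDl// ge_min lexx orbT.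
pose F s := \int[mu]_(u in `[c, s]) g u ord0 i.
have t1 : t < t + 1 by rewrite ltrDl.
have [dF F't] :=
  continuous_FTC1_closed t1 (continuous_integrable c (t + 1) cgi) ct (cgi t).
have dFt : is_derive t 1 (fun s => F s - F a) (g t ord0 i).
  rewrite -[g t ord0 i]subr0; apply: is_deriveB.
  by apply: DeriveDef => //; rewrite -derive1E.
apply: near_eq_is_derive dFt.
near=> s; rewrite /vint mxE (@oriented_integralE _ c)//; first exact: ltW.
by apply: ltW; near: s; exact: lt_nbhsr.
Unshelve. all: by end_near. Qed.

End OrientedIntegral.

(** * Primitives of loops and their derivatives *)

Section VintTheory.
Context {R : realType} {n : nat}.
Notation mu := (@lebesgue_measure R).
Implicit Types (g h : R -> 'rV[R]_n) (v : 'rV[R]_n) (a b c t : R).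

Lemma vint_linear a b c g h : continuous g -> continuous h ->
  vint a b (c *: g + h) = c *: vint a b g + vint a b h.
Proof.
move=> cg ch; apply/rowP => i; rewrite !mxE.
have cgi := continuous_entry (i := i) cg; have chi := continuous_entry (i := i) ch.
have lin a' b' : \int[mu]_(t in `[a', b']) (c *: g + h) t ord0 i =
    c * \int[mu]_(t in `[a', b']) g t ord0 i + \int[mu]_(t in `[a', b']) h t ord0 i.
  rewrite -RintegralZl//; last exact: continuous_integrable.
  rewrite -RintegralD//; [|apply: continuous_integrable..] => //.
    by apply: eq_Rintegral => t _; rewrite !mxE.
  by move=> t; apply: continuousM; [exact: cvg_cst|exact: cgi].
by rewrite !lin mulrBr opprD addrACA.
Qed.

Lemma vint_cst v : vint 0 1 (cst v) = v.
Proof.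
apply/rowP => i; rewrite mxE !Rintegral_cst//.
rewrite /= !lebesgue_measure_itv /= !lte_fin ltr01 ltr10/=.
by rewrite mulr0 subr0 oppr0 addr0 mulr1.
Qed.

Lemma vintaa a g : vint a a g = 0.
Proof. by apply/rowP => i; rewrite !mxE subrr. Qed.

Lemma is_derive_shift (F : R -> 'rV[R]_n) c t v :
  is_derive (t + c) 1 F v -> is_derive t 1 (fun s => F (s + c)) v.
Proof.
move=> dF; have E : (fun r : R => r^-1 *: (F (r *: 1 + (t + c)) - F (t + c))) =
                    (fun r : R => r^-1 *: (F (r *: 1 + t + c) - F (t + c))).
  by apply/funext => r; rewrite addrA.
by case: dF; rewrite /derivable /derive E => dF <-; apply: DeriveDef.
Qed.

End VintTheory.

Section LoopPrimitive.
Context {R : realType} {n s : nat}.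
Implicit Types (u v : loop R n s) (w : 'rV[R]_n) (t : R) (l : nat).

Lemma derive1n_cst_loop w l :
  exists2 w' : 'rV[R]_n, derive1n l (cst w : R -> 'rV[R]_n) = cst w' & `|w'| <= `|w|.
Proof.
case: l => [|l]; first by exists w.
exists 0; last by rewrite normr0.
elim: l => [|l IH]; first by apply/funext => t; rewrite derive1n1 derive1_cst.
by rewrite derive1nS IH; apply/funext => t; rewrite derive1_cst.
Qed.

Lemma cst_loopP w : (cst w : R -> 'rV[R]_n) \in @loops R n s.
Proof.
apply/loopsP; split=> [|//]; split=> [l _ t|].
  by have [w' -> _] := derive1n_cst_loop w l; exact: derivable_cst.
by have [w' -> _] := derive1n_cst_loop w s; exact: cst_continuous.
Qed.

Definition cst_loop w : loop R n s := Loop (cst_loopP w).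

Lemma cst_loop_norm w : loop_norm (cst_loop w) <= `|w|.
Proof.
by apply: loop_norm_le => // l t _; have [w' -> ] := derive1n_cst_loop w l.
Qed.

Lemma continuous_loop u : continuous u.
Proof. exact: (@loop_continuous _ _ _ u 0). Qed.

Lemma loop_average_linear (a : R) u v :
  loop_average (a *: u + v : loop R n s) =
  a *: loop_average u + loop_average v.
Proof. by apply: vint_linear; exact: continuous_loop. Qed.

Lemma loop_average_norm u : `|loop_average u| <= loop_norm u.
Proof.
have H t := @is_derive_vint R n u 0 t (@continuous_loop u).
have := mean_value_le H (fun t => loop_norm_ub u t (leq0n s)) ler01.
by rewrite vintaa !subr0 mulr1.
Qed.

(** Constant maps are loops, so u minus its average is a loop: the bounds on
    loops apply to it, and it is the derivative of [loop_primitive u]. *)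
Definition centered u : loop R n s := u - cst_loop (loop_average u).

Lemma loop_primitiveE u t : loop_primitive u t = vint 0 t (centered u).
Proof. by []. Qed.

Lemma loop_average_centered u : loop_average (centered u) = 0.
Proof.
rewrite /centered addrC -scaleN1r loop_average_linear scaleN1r.
by rewrite [loop_average (cst_loop _)]vint_cst addNr.
Qed.

Lemma centered_norm u : loop_norm (centered u) <= 2 * loop_norm u.
Proof.
rewrite /centered -scaleN1r; apply: le_trans (loop_normD _ _) _.
rewrite loop_normZ normrN1 mul1r mulr2n mulrDl mul1r lerD2l.
exact: le_trans (cst_loop_norm _) (loop_average_norm u).
Qed.

Lemma is_derive_loop_primitive u t :
  is_derive t 1 (loop_primitive u) (centered u t).
Proof. exact: (is_derive_vint 0 t (@continuous_loop (centered u))). Qed.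

Lemma derive1_loop_primitive u : derive1 (loop_primitive u) = centered u.
Proof.
by apply/funext => t; rewrite derive1E; case: (is_derive_loop_primitive u t).
Qed.

(** The increment over one period has derivative zero, and it vanishes at 0
    because the integral of [centered u] over [0, 1] is zero. *)
Lemma loop_primitive_periodic u t : loop_primitive u (t + 1) = loop_primitive u t.
Proof.
pose D (r : R) : 'rV[R]_n := loop_primitive u (r + 1) - loop_primitive u r.
have dD (r : R) : is_derive r 1 D 0.
  have <- : centered u (r + 1) - centered u r = 0.
    by have [_ ->] := loop_is_loop (centered u); rewrite subrr.
  have /is_derive_shift dF := is_derive_loop_primitive u (r + 1).
  exact: is_deriveB dF (is_derive_loop_primitive u r).
have D_const (a b : R) : a <= b -> D b = D a.
  move=> ab; apply/eqP; rewrite -subr_eq0 -normr_le0 -[leRHS](mul0r (b - a)).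
  by apply: mean_value_le dD _ ab => r; rewrite normr0.
have D0 : D 0 = 0.
  rewrite /D add0r !loop_primitiveE vintaa subr0; exact: loop_average_centered.
apply/eqP; rewrite -subr_eq0 -/(D t) -D0; apply/eqP.
by have /orP[/D_const->|/D_const->] := le_total 0 t.
Qed.

(** By periodicity t may be taken in [0, 1], where the bound 2 |u| of the
    derivative bounds the primitive too. *)
Lemma loop_primitive_norm u t : `|loop_primitive u t| <= 2 * loop_norm u.
Proof.
rewrite -(periodicz (- Num.floor t) t (loop_primitive_periodic u)) mulrNz.
set r := t - _; have r0 : 0 <= r by rewrite subr_ge0 floor_le_tmp.
have r1 : r <= 1.
  by rewrite lerBlDl ltW// -[1]/(1%:~R) -intrD floorD1_gt.
have bound t' : `|centered u t'| <= 2 * loop_norm u.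
  exact: le_trans (@loop_norm_ub _ _ _ _ 0 t' _) (centered_norm u).
have := mean_value_le (is_derive_loop_primitive u) bound r0.
rewrite [loop_primitive u 0]loop_primitiveE vintaa !subr0 => /le_trans; apply.
by rewrite ler_piMr// mulr_ge0// loop_norm_ge0.
Qed.

(** Treating the primitive and its derivatives as one family indexed by l lets a
    single chain rule serve for all of them. *)
Definition primitive_jet l u t : 'rV[R]_n := derive1n l (loop_primitive u) t.

Lemma primitive_jetS l u : primitive_jet l.+1 u = derive1n l (centered u).
Proof. by rewrite /primitive_jet derive1Sn derive1_loop_primitive. Qed.

Lemma is_derive_primitive_jet l u t : (l <= s)%N ->
  is_derive t 1 (primitive_jet l u) (primitive_jet l.+1 u t).
Proof.
move=> ls; apply: DeriveDef; last by rewrite -derive1E.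
case: l ls => [|l] ls; first by case: (is_derive_loop_primitive u t).
by rewrite primitive_jetS; exact: loop_derivable.
Qed.

Lemma continuous_primitive_jet l u : (l <= s.+1)%N -> continuous (primitive_jet l u).
Proof.
case: l => [_ t|l ls]; last by rewrite primitive_jetS; exact: loop_continuous.
apply: differentiable_continuous; apply/derivable1_diffP.
by case: (is_derive_loop_primitive u t).
Qed.

Lemma primitive_jet_linear l (a : R) u v t : (l <= s.+1)%N ->
  primitive_jet l (a *: u + v) t = a *: primitive_jet l u t + primitive_jet l v t.
Proof.
move=> ls; rewrite /primitive_jet.
have -> : loop_primitive (a *: u + v : loop R n s) =
    a *: loop_primitive u + loop_primitive v.
  apply/funext => r; rewrite /GRing.add /= /GRing.scale /= !loop_primitiveE.
  rewrite -vint_linear; [|exact: continuous_loop..]; congr vint.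
  apply/funext => q; rewrite /GRing.add /= /GRing.scale /=.
  by rewrite loop_average_linear scalerBr opprD addrACA.
have diff (w : loop R n s) l' : (l' < l)%N ->
    forall r, derivable (derive1n l' (loop_primitive w)) r 1.
  move=> ll r; have ls' : (l' <= s)%N := leq_trans ll ls.
  by case: (is_derive_primitive_jet w r ls').
by rewrite derive1n_lin // => l'; exact: diff.
Qed.

Lemma primitive_jetB l u v t : (l <= s.+1)%N ->
  primitive_jet l (u - v) t = primitive_jet l u t - primitive_jet l v t.
Proof.
move=> ls; rewrite -scaleN1r addrC (primitive_jet_linear _ _ _ _ ls).
by rewrite scaleN1r addrC.
Qed.

Lemma primitive_jetZ l (a : R) u t : (l <= s.+1)%N ->
  primitive_jet l (a *: u) t = a *: primitive_jet l u t.
Proof.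
move=> ls; have jet0 : primitive_jet l (0 : loop R n s) t = 0.
  by rewrite -(subrr u) (primitive_jetB _ _ _ ls) subrr.
by rewrite -[a *: u]addr0 (primitive_jet_linear _ _ _ _ ls) jet0 addr0.
Qed.

Lemma primitive_jet_norm l u t : (l <= s.+1)%N ->
  `|primitive_jet l u t| <= 2 * loop_norm u.
Proof.
case: l => [_|l ls]; first exact: loop_primitive_norm.
rewrite primitive_jetS.
exact: le_trans (loop_norm_ub (centered u) t ls) (centered_norm u).
Qed.

End LoopPrimitive.

(** * Partial derivatives and C^r maps on the cube *)

Section CubeTheory.
Context {R : realType} {m : nat} {V : normedModType R}.
Implicit Types (f g : 'rV[R]_m -> V) (x : 'rV[R]_m) (i : 'I_m).

Definition has_partial i f x (l : V) := cube_quot i f x @ cube_dnbhs i x --> l.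

Lemma cube_stepE i x (h : R) k :
  cube_step i x h ord0 k = x ord0 k + h * (k == i)%:R.
Proof. by rewrite /cube_step !mxE eqxx. Qed.

Lemma cube_dnbhs_filter i x : Filter (cube_dnbhs i x).
Proof. exact: within_filter. Qed.

(** Properness makes the one-sided limits that define [partial] unique; it holds
    since from any point of the cube one can move in direction i or -i. *)
Lemma cube_dnbhs_proper i x : cube x -> ProperFilter (cube_dnbhs i x).
Proof.
move=> cx; apply: Build_ProperFilter_ex.
move=> A [e /= e0 eA].
have /(_ i) := cx; rewrite in_itv /= => /andP[xi0 xi1].
pose d := Num.min (e / 2) (1 / 2).
have d0 : 0 < d by rewrite lt_min !divr_gt0.
have de : d < e by rewrite gt_min ltr_pdivrMr// ltr_pMr// ltr1n.
have d2 : d <= 1 / 2 by rewrite ge_min lexx orbT.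
(* Step towards the farther of the two faces. *)
pose h := if x ord0 i <= 1 / 2 then d else - d.
have nh : `|h| = d by rewrite /h; case: ifP => _; rewrite ?normrN ger0_norm// ltW.
exists h; apply: eA => /=.
- by rewrite sub0r normrN nh.
- by rewrite -normr_gt0 nh.
move=> k; rewrite cube_stepE; have [->|_] := eqVneq k i; last by rewrite mulr0 addr0.
rewrite mulr1 in_itv /= /h; clearbody d.
by case: (leP (x ord0 i) (1 / 2)) => hx; apply/andP; split; lra.
Qed.

Lemma cube_dnbhs_cvg i x : cube_dnbhs i x --> (0 : R)^'.
Proof. exact: cvg_within. Qed.

Lemma near_cube_dnbhs i x : \forall h \near cube_dnbhs i x, cube (cube_step i x h).
Proof. by rewrite /cube_dnbhs near_withinE; near=> h. Unshelve. all: by end_near. Qed.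

Lemma within_cube_continuousP f :
  {within cube, continuous f} <-> forall x, cube x -> f @ within cube (nbhs x) --> f x.
Proof. exact: subspace_continuousP. Qed.

Lemma has_partialE i f x l : cube x -> has_partial i f x l -> partial i f x = l.
Proof. by move=> /(cube_dnbhs_proper i) PF; apply: cvg_lim; exact: norm_hausdorff. Qed.

Lemma eq_has_partial i f g x l : {in cube, f =1 g} -> cube x ->
  has_partial i f x l -> has_partial i g x l.
Proof.
move=> fg cx; apply: cvg_trans; apply: near_eq_cvg.
have FF := cube_dnbhs_filter i x.
near=> h; rewrite /cube_quot !fg ?inE//; near: h; exact: near_cube_dnbhs.
Unshelve. all: by end_near. Qed.

Lemma eq_within_cube f g : {in cube, f =1 g} ->
  {within cube, continuous f} -> {within cube, continuous g}.
Proof.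
move=> fg; move/within_cube_continuousP => cf.
apply/within_cube_continuousP => x cx.
rewrite -fg ?inE//; apply: cvg_trans (cf x cx); apply: near_eq_cvg.
by rewrite near_withinE; near=> y => cy; rewrite fg ?inE.
Unshelve. all: by end_near. Qed.

Lemma has_partialDZ i f g x (a : R) u v : has_partial i f x u -> has_partial i g x v ->
  has_partial i (fun y => f y + a *: g y) x (u + a *: v).
Proof.
move=> fu gv; rewrite /has_partial.
have -> : cube_quot i (fun y => f y + a *: g y) x =
    (fun h => cube_quot i f x h + a *: cube_quot i g x h).
  apply/funext => h.
  rewrite /cube_quot [a *: (h^-1 *: _)]scalerA mulrC -scalerA -scalerDr.
  by congr (_ *: _); rewrite scalerBr opprD addrACA.
have FF := cube_dnbhs_filter i x.
by apply: cvgD => //; apply: cvgZl_tmp.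
Qed.

End CubeTheory.

Section CubeClass.
Context {R : realType} {m : nat} {V : normedModType R}.
Implicit Types (f g : 'rV[R]_m -> V) (x : 'rV[R]_m) (i : 'I_m).

(** The values outside of the cube are irrelevant.  This is needed because the
    formulas for partial derivatives only hold at points of the cube. *)
Lemma eq_cube_class r f g : {in cube, f =1 g} -> cube_class r f -> cube_class r g.
Proof.
elim: r f g => [|r IH] f g fg /=; first exact: eq_within_cube.
move=> [cf df]; split=> [|i]; first exact: eq_within_cube cf.
have [dfi Cfi] := df i; split=> [x cx|].
  by apply/cvg_ex; exists (partial i f x); exact: (eq_has_partial fg cx (dfi x cx)).
apply: IH Cfi => x /set_mem cx; apply/esym/has_partialE => //.
by exact: (eq_has_partial fg cx (dfi x cx)).
Qed.

Lemma cube_class_continuous r f : cube_class r f -> {within cube, continuous f}.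
Proof. by case: r => [|r] //= []. Qed.

Lemma cube_classS r f (df : 'I_m -> 'rV[R]_m -> V) :
  {within cube, continuous f} ->
  (forall i x, cube x -> has_partial i f x (df i x)) ->
  (forall i, cube_class r (df i)) -> cube_class r.+1 f.
Proof.
move=> cf dfP cdf; split=> // i; split=> [x cx|].
  by apply/cvg_ex; exists (df i x); exact: dfP.
apply: eq_cube_class (cdf i) => x /set_mem cx.
by apply/esym/has_partialE => //; exact: dfP.
Qed.

Lemma cube_class_partial r i f x :
  cube_class r.+1 f -> cube x -> has_partial i f x (partial i f x).
Proof. by move=> [_ /(_ i)[+ _]]; exact. Qed.

Lemma cube_classW r f : cube_class r.+1 f -> cube_class r f.
Proof.
elim: r f => [|r IH] f; first exact: cube_class_continuous.
by move=> [cf df]; split=> // i; have [dfi /IH] := df i.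
Qed.

Lemma cube_classDZ r (a : R) f g : cube_class r f -> cube_class r g ->
  cube_class r (fun x => f x + a *: g x).
Proof.
have cDZ f' g' : {within cube, continuous f'} -> {within cube, continuous g'} ->
    {within cube, continuous (fun x => f' x + a *: g' x)}.
  move=> /within_cube_continuousP cf /within_cube_continuousP cg.
  apply/within_cube_continuousP => x cx.
  by apply: cvgD; [exact: cf|apply: cvgZl_tmp; exact: cg].
elim: r f g => [|r IH] f g; first exact: cDZ.
move=> Cf Cg; apply: (@cube_classS _ _ (fun i x => partial i f x + a *: partial i g x)).
- by apply: cDZ; [case: Cf|case: Cg].
- move=> i x cx.
  exact: has_partialDZ (cube_class_partial Cf cx) (cube_class_partial Cg cx).
- by move=> i; apply: IH; [case: Cf => _ /(_ i)[]|case: Cg => _ /(_ i)[]].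
Qed.

Lemma compact_cube : compact (@cube R m).
Proof.
exact: (@rV_compact _ _ (fun=> `[(0 : R), 1]%classic) (fun=> @segment_compact R 0 1)).
Qed.

Lemma within_cube_bounded f : {within cube, continuous f} ->
  exists2 C : R, 0 <= C & forall x, cube x -> `|f x| <= C.
Proof.
move=> cf; have [M [_ MP]] := compact_bounded (continuous_compact cf compact_cube).
exists (`|M| + 1) => [|x cx]; first by rewrite addr_ge0.
by apply: (MP (`|M| + 1)); [rewrite (le_lt_trans (ler_norm _))// ltrDl|exists x].
Qed.

End CubeClass.

(** * Corrugated families of loops *)

Section Corrugation.
Context {R : realType} {m n s : nat}.
Implicit Types (G H : 'rV[R]_m -> loop R n s) (x : 'rV[R]_m) (i j : 'I_m) (l r : nat).

(** Joint continuity: the uniform bound on J_l controls the change of loop, and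
    continuity in t is then only used at the fixed loop u. *)
Lemma cvg_primitive_jet (T : Type) (F : set_system T) (tau : T -> R)
    (v : T -> loop R n s) (t : R) (u : loop R n s) l : Filter F -> (l <= s.+1)%N ->
  tau @ F --> t -> v @ F --> u ->
  primitive_jet l (v h) (tau h) @[h --> F] --> primitive_jet l u t.
Proof.
move=> FF ls ct cv.
have split_jet h : primitive_jet l (v h) (tau h) =
    primitive_jet l (v h - u) (tau h) + primitive_jet l u (tau h).
  by rewrite primitive_jetB// subrK.
rewrite (funext split_jet).
rewrite -[primitive_jet l u t]add0r; apply: cvgD; last first.
  exact: (cvg_comp _ _ ct (@continuous_primitive_jet _ _ _ l u ls t)).
apply: norm_cvg0; apply: (@squeeze_cvgr _ _ _ _ (cst 0) (fun h => 2 * `|v h - u|)).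
- by near=> h; rewrite normr_ge0 primitive_jet_norm.
- exact: cvg_cst.
- rewrite -[X in _ --> X](mulr0 2); apply: cvgM; first exact: cvg_cst.
  by rewrite -[X in _ --> X](@normr0 _ (loop R n s)); apply: cvg_norm; exact/subr_cvg0.
Unshelve. all: by end_near. Qed.

Lemma is_derive_dir (W : normedModType R) (F : R -> W) (t d : R) (w : W) :
  is_derive t 1 F w -> is_derive t d F (d *: w).
Proof.
move=> [/derivable1_diffP dF <-]; apply: DeriveDef; first exact: diff_derivable.
by rewrite !deriveE// -[X in 'd F t X](mulr1 d) linearZ.
Qed.

(** Adding and subtracting J_l (G x) at the displaced time splits the difference
    quotient in two: J_l is applied to the difference quotient of G, which
    [cvg_primitive_jet] handles, and the remaining quotient is that of the
    derivative of J_l (G x) in the direction d = N [i = j]. *)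
Lemma has_partial_jet l G (N : R) i j x (g : loop R n s) : (l <= s)%N -> cube x ->
  has_partial i G x g ->
  has_partial i (fun y => primitive_jet l (G y) (N * y ord0 j)) x
    (primitive_jet l g (N * x ord0 j) +
     (N * (i == j)%:R) *: primitive_jet l.+1 (G x) (N * x ord0 j)).
Proof.
move=> ls cx Gg; set t := N * x ord0 j; set d := N * (i == j)%:R.
have FF := cube_dnbhs_filter i x.
have tauE h : N * cube_step i x h ord0 j = h *: d + t.
  by rewrite cube_stepE mulrDr addrC eq_sym /t /d /GRing.scale /= mulrCA.
rewrite /has_partial.
have -> : cube_quot i (fun y => primitive_jet l (G y) (N * y ord0 j)) x =
  (fun h => primitive_jet l (cube_quot i G x h) (h *: d + t) +
     h^-1 *: (primitive_jet l (G x) (h *: d + t) - primitive_jet l (G x) t)).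
  apply/funext => h; rewrite /cube_quot tauE.
  have ls1 : (l <= s.+1)%N by exact: leqW.
  rewrite (primitive_jetZ _ _ _ ls1) (primitive_jetB _ _ _ ls1).
  by rewrite -scalerDr addrA subrK.
have c0 := @cube_dnbhs_cvg R m i x.
apply: cvgD.
  apply: cvg_primitive_jet => //; first exact: leqW.
  rewrite -[X in _ --> X]add0r -[X in _ --> X + _](scale0r d).
  apply: cvgD; last exact: cvg_cst.
  by apply: cvgZr_tmp; apply: cvg_trans c0 _; exact: cvg_within.
have [dj <-] := is_derive_dir d (is_derive_primitive_jet (G x) t ls).
exact: cvg_trans (cvg_app _ c0) dj.
Qed.

(** Each partial derivative takes at most one derivative in t, so those of order
    up to r only meet the jets J_l, ..., J_(l+r). *)
Lemma jet_class r l G (N : R) j : (l + r <= s.+1)%N -> cube_class r G ->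
  cube_class r (fun x => primitive_jet l (G x) (N * x ord0 j)).
Proof.
have within_jet l' G' : (l' <= s.+1)%N -> {within cube, continuous G'} ->
    {within cube, continuous (fun x => primitive_jet l' (G' x) (N * x ord0 j))}.
  move=> ls /within_cube_continuousP cG'; apply/within_cube_continuousP => x cx.
  apply: cvg_primitive_jet => //; last exact: cG'.
  apply: cvg_within_filter; apply: cvgM; first exact: cvg_cst.
  exact: coord_continuous.
elim: r l G => [|r IH] l G lrs CG.
  by apply: within_jet CG; rewrite addn0 in lrs.
have ls : (l <= s)%N by apply: leq_trans (leq_addr r l) _; rewrite addnS in lrs.
apply: (@cube_classS _ _ _ _ _ (fun i x =>
  primitive_jet l (partial i G x) (N * x ord0 j) +
  (N * (i == j)%:R) *: primitive_jet l.+1 (G x) (N * x ord0 j))).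
- by apply: within_jet (cube_class_continuous CG); exact: leqW.
- by move=> i x cx; apply: has_partial_jet => //; exact: (cube_class_partial CG).
- move=> i; apply: cube_classDZ.
    by apply: IH; [rewrite addnS in lrs; exact: ltnW|case: CG => _ /(_ i)[]].
  by apply: IH; [rewrite addSnnS|exact: cube_classW].
Qed.

Lemma corrugationE (f0 : 'rV[R]_m -> 'rV[R]_n) G j (N : R) :
  corrugation f0 G j N = (fun x => f0 x + N^-1 *: primitive_jet 0 (G x) (N * x ord0 j)).
Proof. by []. Qed.

Lemma corrugation_class (f0 : 'rV[R]_m -> 'rV[R]_n) G j (N : R) :
  cube_class s.+1 f0 -> cube_class s.+1 G -> cube_class s.+1 (corrugation f0 G j N).
Proof.
move=> Cf CG; rewrite corrugationE; apply: cube_classDZ => //.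
exact: jet_class.
Qed.

(** The factor N from the chain rule cancels N^-1: this is why the derivative
    along j, and only that one, is modified at order 1. *)
Lemma partial_corrugation (f0 : 'rV[R]_m -> 'rV[R]_n) G i j (N : R) x :
  cube_class s.+1 f0 -> cube_class s.+1 G -> cube x -> N != 0 ->
  partial i (corrugation f0 G j N) x =
  partial i f0 x + N^-1 *: primitive_jet 0 (partial i G x) (N * x ord0 j) +
  (i == j)%:R *: centered (G x) (N * x ord0 j).
Proof.
move=> Cf CG cx N0; apply: has_partialE => //.
have -> : (i == j)%:R *: centered (G x) (N * x ord0 j) =
    N^-1 *: ((N * (i == j)%:R) *: primitive_jet 1 (G x) (N * x ord0 j)).
  by rewrite primitive_jetS scalerA mulKf.
rewrite -addrA -scalerDr; apply: has_partialDZ; first exact: (cube_class_partial Cf).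
by apply: has_partial_jet => //; exact: (cube_class_partial CG).
Qed.

Lemma jet_field_bound H j : {within cube, continuous H} ->
  exists C : R, forall N : R, 0 < N -> forall x, cube x ->
    `|N^-1 *: primitive_jet 0 (H x) (N * x ord0 j)| <= C / N.
Proof.
move=> /within_cube_bounded[C C0 HC]; exists (2 * C) => N N0 x cx.
rewrite normrZ gtr0_norm ?invr_gt0// mulrC ler_pM2r ?invr_gt0//.
apply: le_trans (primitive_jet_norm _ _ _) _ => //.
by rewrite ler_pM2l//; exact: HC.
Qed.

Lemma cube_supnorm_le (f : 'rV[R]_m -> 'rV[R]_n) (C : R) :
  (forall x, cube x -> `|f x| <= C) -> (cube_supnorm f <= C%:E)%E.
Proof. by move=> fC; apply: ge_ereal_sup => _ [x cx <-]; rewrite lee_fin fC. Qed.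

(** With s in place of k - 2 the regularity indices are successors, on which
    [cube_class] reduces. *)
Lemma corrugation_process (f0 : 'rV[R]_m -> 'rV[R]_n) G j :
  cube_class s.+1 f0 -> cube_class s.+1 G ->
  let f1 N := corrugation f0 G j N in
  [/\ forall N : R, 0 < N -> cube_class s.+1 (f1 N),
      exists C : R, forall N : R, 0 < N ->
        (cube_supnorm (fun x => f0 x - f1 N x)%R <= (C / N)%:E)%E,
      forall i : 'I_m, i != j ->
        exists C : R, forall N : R, 0 < N ->
          (cube_supnorm (fun x => partial i f0 x - partial i (f1 N) x)%R
             <= (C / N)%:E)%E
    & (forall x, cube x -> partial j f0 x = loop_average (G x)) ->
      exists C : R, forall N : R, 0 < N -> forall x, cube x ->
        `|partial j (f1 N) x - G x (N * x ord0 j)| <= C / N].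
Proof.
move=> Cf CG f1.
have CdG i : {within cube, continuous (partial i G)}.
  by apply: (@cube_class_continuous _ _ _ s); case: CG => _ /(_ i)[].
split=> [N N0||i ij|avg].
- exact: corrugation_class.
- have [C HC] := jet_field_bound j (cube_class_continuous CG).
  exists C => N N0; apply: cube_supnorm_le => x cx.
  by rewrite opprD addNKr normrN; exact: HC.
- have [C HC] := jet_field_bound j (CdG i).
  exists C => N N0; apply: cube_supnorm_le => x cx.
  rewrite partial_corrugation ?(lt0r_neq0 N0)// (negbTE ij) scale0r addr0.
  by rewrite opprD addNKr normrN; exact: HC.
- have [C HC] := jet_field_bound j (CdG j).
  exists C => N N0 x cx; rewrite partial_corrugation ?(lt0r_neq0 N0)// eqxx scale1r avg//.
  have -> : centered (G x) (N * x ord0 j) =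
    G x (N * x ord0 j) - loop_average (G x) by [].
  rewrite -addrA (addrAC (G x _)) subrr add0r addrAC subrr add0r.
  exact: HC.
Qed.

End Corrugation.

Theorem proposition8 (R : realType) (m n k : nat)
    (f0 : 'rV[R]_m -> 'rV[R]_n) (j : 'I_m)
    (gamma : 'rV[R]_m -> loop R n (k - 2)) :
  (2 <= k)%N ->
  cube_class k f0 ->
  cube_class (k - 1) gamma ->
  let f1 (N : R) : 'rV[R]_m -> 'rV[R]_n := corrugation f0 gamma j N in
  [/\ forall N : R, 0 < N -> cube_class (k - 1) (f1 N),
      exists C : R, forall N : R, 0 < N ->
        (cube_supnorm (fun x => f0 x - f1 N x)%R <= (C / N)%:E)%E,
      forall i : 'I_m, i != j ->
        exists C : R, forall N : R, 0 < N ->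
          (cube_supnorm (fun x => partial i f0 x - partial i (f1 N) x)%R
             <= (C / N)%:E)%E
    & (forall x, cube x -> partial j f0 x = loop_average (gamma x)) ->
      exists C : R, forall N : R, 0 < N -> forall x, cube x ->
        `|partial j (f1 N) x - gamma x (N * x ord0 j)| <= C / N].
Proof.
move=> k2 Cf.
have k1E : (k - 1 = (k - 2).+1)%N by rewrite -subSn.
have kE : k = (k - 2).+2 by rewrite -addn2 subnK.
rewrite k1E => Cg; apply: corrugation_process => //.
by apply: cube_classW; rewrite -kE.
Qed.
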